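(* For the distributed minimum variance estimator described in the context, for every node $i$ and every time $t\ge1$, the expected estimation error variance satisfies $$\mathbb{E}_{\phi}\,\mathbb{E}_v\big(e_i(t)-\mathbb{E}_v e_i(t)\big)^2\ \le\ \frac{(\sqrt5-1)\sqrt{\gamma_{\max}}+2N}{2(\sqrt5-1)\sqrt{\gamma_{\max}}+2N}\cdot\sum_{k=0}^{|\mathcal{N}_i|-1}\frac{\chi(k)}{k+1}\;\sigma^2,$$ where $$\chi(k)=\sum_{\substack{A\subseteq\mathcal{N}_i\setminus\{i\}\\ |A|=k}}\ \prod_{j\in A}p_{ij}\prod_{j\in\mathcal{N}_i\setminus(A\cup\{i\})}q_{ij}.$$
   Context: Setting. There are $N>1$ nodes; $\mathcal{N}_i$ is the set consisting of node $i$ and its neighbors in a fixed graph on $\{1,\dots,N\}$. At each $t\in\mathbb{N}_0$ node $i$ measures $u_i(t)=d(t)+v_i(t)$, where $d(t)$ is a scalar signal and the $v_i(t)$ are zero-mean Gaussian with variance $\sigma^2>0$, uncorrelated between distinct nodes and over time. $\phi_{ij}(t)\in\{0,1\}$ indicates that node $i$ receives the packet of node $j$ at time $t$; these variables ($i\neq j$) are independent among links and over time and independent of the noise, with $\Pr(\phi_{ij}(t)=1)=p_{ij}$, $q_{ij}=1-p_{ij}$, $p_{ii}=1$, and $p_{ij}=0$ for $j\notin\mathcal{N}_i$. $\phi_i(t)=(\phi_{i1}(t),\dots,\phi_{iN}(t))^T$, with realization $\varphi_{i|t}$, and $\mathcal{N}_{\varphi_i}=\{j\in\mathcal{N}_i:\text{the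 }j\text{-th component of }\varphi_{i|t}\text{ is }1\}$. Estimator. $x_i(0)=u_i(0)$ and, for $t\ge1$, $x_i(t)=(\mathbf{k}_i(t)\circ\varphi_{i|t})^T\mathbf{x}(t-1)+(\mathbf{h}_i(t)\circ\varphi_{i|t})^T\mathbf{u}(t)$, with $\mathbf{x}=(x_1,\dots,x_N)^T$, $\mathbf{u}=(u_1,\dots,u_N)^T$, $\circ$ the Hadamard product. The error is $e_i(t)=x_i(t)-d(t)$; $\mathbb{E}_v$ is expectation over the measurement noise (for given packet losses), $\mathbb{E}_\phi$ expectation over the packet losses. $\mathbf{P}(t-1)$ is the $N\times N$ covariance matrix (with respect to the noise) of $(e_1(t-1),\dots,e_N(t-1))^T$. At each $t\ge1$, given $\mathbf{P}(t-1)$ and $\varphi_{i|t}$, node $i$ uses the weights $\mathbf{k}_i(t),\mathbf{h}_i(t)\in\mathbb{R}^N$ that minimize the error variance $(\mathbf{k}_i\circ\varphi_{i|t})^T\mathbf{P}(t-1)(\mathbf{k}_i\circ\varphi_{i|t})+\sigma^2\|\mathbf{h}_i\circ\varphi_{i|t}\|^2$ subject to $\big((\mathbf{k}_i+\mathbf{h}_i)\circ\varphi_{i|t}\big)^T\mathbf{1}=1$ and $\|\mathbf{k}_i\circ\varphi_{i|t}\|^2\le\psi_i(t)$. Thresholds. $0<\gamma_{\max}<1$ is fixed and $\psi(t)=(\psi_1(t),\dots,\psi_N(t))^T$ with positive entries is the solution of $\psi_i+\sqrt{\psi_i}\sum_{j\in\Theta_{\varphi_i}}\sqrt{\psi_j}=\gamma_{\max}$,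 $i=1,\dots,N$, where $\Theta_{\varphi_i}=\{j\ne i:\mathcal{N}_{\varphi_i}\cap\mathcal{N}_{\varphi_j}\ne\emptyset\}\cup(\mathcal{N}_{\varphi_i}\setminus\{i\})$. *)

(* Defs.v *)
From HB Require Import structures.
From mathcomp Require Import all_boot all_order all_algebra.
From mathcomp Require Import all_classical all_reals all_analysis.

Set Implicit Arguments.
Unset Strict Implicit.
Unset Printing Implicit Defensive.

Import Order.TTheory GRing.Theory Num.Theory.
Import numFieldNormedType.Exports.

Local Open Scope ring_scope.

(* A packet pattern at a fixed time is a boolean relation b, where b i j says
   that node i receives the packet of node j. *)

Definition neighborhood (N : nat) (adj : rel 'I_N) (i : 'I_N) : {set 'I_N} :=
  [set j | (j == i) || adj i j]%SET.

Definition received (N : nat) (adj : rel 'I_N) (b : rel 'I_N) (i : 'I_N) :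
    {set 'I_N} :=
  [set j in neighborhood adj i | b i j]%SET.

(* The set Theta coupling the threshold of node i to the other thresholds. *)
Definition coupled (N : nat) (adj : rel 'I_N) (b : rel 'I_N) (i : 'I_N) :
    {set 'I_N} :=
  [set j | (j != i) && (received adj b i :&: received adj b j != finset.set0)]%SET
    :|: (received adj b i :\ i).

Definition is_threshold (R : realType) (N : nat) (adj : rel 'I_N)
    (gamma : R) (b : rel 'I_N) (psi : 'I_N -> R) : Prop :=
  forall i : 'I_N, 0 < psi i /\
    psi i + Num.sqrt (psi i) * (\sum_(j in coupled adj b i) Num.sqrt (psi j))
      = gamma.

Definition packet_vector (R : realType) (N : nat) (b : rel 'I_N) (i : 'I_N) :
    'cV[R]_N :=
  \col_j (b i j)%:R.

Definition hadamard (R : realType) (N : nat) (x y : 'cV[R]_N) : 'cV[R]_N :=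
  map2_mx *%R x y.

Definition dot (R : realType) (N : nat) (x y : 'cV[R]_N) : R :=
  (x^T *m y) 0 0.

(* Here m is the packet vector of the node, and P the error covariance matrix
   of the previous time step. *)
Definition error_variance (R : realType) (N : nat) (sigma : R)
    (P : 'M[R]_N) (m k h : 'cV[R]_N) : R :=
  dot (hadamard k m) (P *m hadamard k m)
    + sigma ^+ 2 * dot (hadamard h m) (hadamard h m).

Definition admissible_weights (R : realType) (N : nat) (psi : R)
    (m k h : 'cV[R]_N) : Prop :=
  dot (hadamard (k + h) m) (const_mx 1) = 1 /\
  dot (hadamard k m) (hadamard k m) <= psi.

(* P may be singular, so that a minimizer need not be unique. *)
Definition optimal_weights (R : realType) (N : nat) (sigma psi : R)
    (P : 'M[R]_N) (m k h : 'cV[R]_N) : Prop :=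
  admissible_weights psi m k h /\
  forall k' h' : 'cV[R]_N, admissible_weights psi m k' h' ->
    error_variance sigma P m k h <= error_variance sigma P m k' h'.

Fixpoint estimate (R : realType) (N : nat) (u : nat -> 'cV[R]_N)
    (b : nat -> rel 'I_N) (K H : nat -> 'I_N -> 'cV[R]_N) (t : nat) :
    'cV[R]_N :=
  if t is s.+1 then
    \col_i (dot (hadamard (K t i) (packet_vector R (b t) i))
              (estimate u b K H s)
            + dot (hadamard (H t i) (packet_vector R (b t) i)) (u t))
  else u 0%N.

(* The estimation errors for the signal d, the noise realization v, the packet
   patterns b and the weights K, H. *)
Definition estimation_error (R : realType) (N : nat) (d : nat -> R)
    (v : nat -> 'I_N -> R) (b : nat -> rel 'I_N)
    (K H : nat -> 'I_N -> 'cV[R]_N) (t : nat) (i : 'I_N) : R :=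
  estimate (fun s => \col_j (d s + v s j)) b K H t i 0 - d t.

Definition covariance_mx (dT : measure_display) (T : measurableType dT)
    (R : realType) (P : probability T R) (N : nat) (X : 'I_N -> T -> R) :
    'M[R]_N :=
  \matrix_(i, j) fine (covariance P (X i) (X j)).

(* Mutual independence of the random variables X x with x in D. *)
Definition mutually_independent (dT dT' : measure_display)
    (T : measurableType dT) (T' : measurableType dT') (R : realType)
    (P : probability T R) (I : choiceType) (D : pred I)
    (X : I -> {RV P >-> T'}) : Prop :=
  forall (s : seq I) (B : I -> set T'), uniq s -> all D s ->
    (forall x, measurable (B x)) ->
    P (\bigcap_(x in [set` s]) (X x @^-1` B x))%classic
      = (\prod_(x <- s) P (X x @^-1` B x)%classic)%E.

(* The probability that, besides its own, node i receives exactly k packets. *)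
Definition chi (R : realType) (N : nat) (adj : rel 'I_N)
    (p : 'I_N -> 'I_N -> R) (i : 'I_N) (k : nat) : R :=
  \sum_(A : {set 'I_N} | (A \subset neighborhood adj i :\ i) && (#|A| == k))
    (\prod_(j in A) p i j)
    * (\prod_(j in neighborhood adj i :\: (i |: A)) (1 - p i j)).

(* Main.v *)
(** For fixed packet losses, node [i] could always put weight
    [c = (sqrt 5 - 1) / 2 * sqrt gamma / N] on its own previous estimate and
    spread [1 - c] evenly over the [M] measurements that it receives: this is
    admissible because [sqrt psi_i >= sqrt gamma / N].  As the error variances
    stay below [sigma ^ 2], comparison with these weights bounds the variance of
    the optimal estimate by [(1 + c) / (1 + 2 c) * sigma ^ 2 / M], using
    [M c <= 2 / 3] and [c <= 1 / 2].  The expectation of [1 / M] over the losses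
    is [\sum_k chi(k) / (k + 1)].  Of the Gaussian law only the bound
    [sigma ^ 2] on the second moment is used. *)

Require Import Defs.
From HB Require Import structures.
From mathcomp Require Import all_boot all_order all_algebra.
From mathcomp Require Import all_classical all_reals all_analysis.
From mathcomp Require Import measurable_realfun ring lra.

Set Implicit Arguments.
Unset Strict Implicit.
Unset Printing Implicit Defensive.

Import Order.TTheory GRing.Theory Num.Theory.
Import numFieldNormedType.Exports HBNNSimple.

Local Open Scope ring_scope.

(** * Integration: comparison of integrals, densities, the Gaussian second moment *)

(** The integral of a nonnegative [f] is a supremum over simple functions below [f]; each of these
    is measurable and almost everywhere below [g]. This spares a measurability proof for the noise
    variance as a function of the losses. *)
Lemma ae_ge0_le_integral_nonmeasurable (dT : measure_display)
    (T : measurableType dT) (R : realType) (mu : {measure set T -> \bar R})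
    (f g : T -> \bar R) :
  (forall x, (0 <= f x)%E) -> (forall x, (0 <= g x)%E) ->
  measurable_fun setT g -> {ae mu, forall x, (f x <= g x)%E} ->
  (\int[mu]_x f x <= \int[mu]_x g x)%E.
Proof.
move=> f0 g0 mg fg; rewrite [leLHS]ge0_integralTE//.
apply: ge_ereal_sup => _ [h /= hf <-].
rewrite -integralT_nnsfun; apply: ae_ge0_le_integral => //.
- by move=> x _; rewrite lee_fin.
- exact/measurable_EFinP.
- by apply: filterS fg => x fgx _; exact: le_trans (hf x) fgx.
Qed.

Section density.
Context (dT : measure_display) (T : measurableType dT) (R : realType).
Variables (mu nu : {measure set T -> \bar R}) (g : T -> R).
Hypotheses (g0 : forall x, 0 <= g x) (mg : measurable_fun setT g).
Hypothesis nuE :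
  forall A, measurable A -> nu A = (\int[mu]_(x in A) (g x)%:E)%E.


(** For a simple function both sides split over its level sets, where [nuE] applies. *)
Let integral_density_nnsfun (h : {nnsfun T >-> R}) :
  (\int[nu]_x (h x)%:E = \int[mu]_x ((h x)%:E * (g x)%:E))%E.
Proof.
under eq_integral do rewrite fimfunE// -fsumEFin//.
rewrite ge0_integral_fsum//; last 2 first.
- by move=> y; exact/measurable_EFinP/measurable_funM.
- by move=> y x _; rewrite nnfun_muleindic_ge0.
transitivity (\int[mu]_x \sum_(k \in range h)
    (k * \1_(h @^-1` [set k]) x * g x)%:E)%E; last first.
  apply: eq_integral => x _; rewrite [in RHS]fimfunE// fsumEFin// -EFinM.
  by rewrite mulr_fsuml.
rewrite ge0_integral_fsum//; last 2 first.
- move=> y; apply/measurable_EFinP/measurable_funM => //.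
  exact/measurable_funM.
- move=> y x _; rewrite lee_fin mulr_ge0//.
  by have := nnfun_muleindic_ge0 h y x; rewrite lee_fin.
apply: eq_fsbigr => r /[!inE] -[t _ hr].
rewrite integralZl_indic_nnsfun// integral_indic//= setIT nuE//.
under [RHS]eq_integral do rewrite -mulrA EFinM.
rewrite ge0_integralZl_EFin//=; last 3 first.
- by move=> x _; rewrite lee_fin mulr_ge0.
- by apply/measurable_EFinP/measurable_funM.
- by rewrite -hr.
congr (_ * _)%E; rewrite [LHS]integral_mkcond; apply: eq_integral => x _.
by rewrite patchE indicE; case: ifPn => _; rewrite ?mul1r ?mul0r.
Qed.

(** Monotone convergence along increasing simple approximations of [f], applied to both sides. *)
Lemma integral_density (f : T -> \bar R) :
  measurable_fun setT f -> (forall x, (0 <= f x)%E) ->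
  (\int[nu]_x f x = \int[mu]_x (f x * (g x)%:E))%E.
Proof.
move=> mf f0; pose h := nnsfun_approx measurableT mf.
have hf x : ((EFin \o h^~ x) @ \oo --> f x)%classic.
  by apply: cvg_nnsfun_approx.
transitivity (limn (fun n => \int[nu]_x (h n x)%:E)%E).
  rewrite -monotone_convergence//.
  - by apply: eq_integral => x _; apply/esym/cvg_lim => //; exact: hf.
  - by move=> n; exact/measurable_EFinP.
  - by move=> n x _; rewrite lee_fin.
  - by move=> x _ m n mn; rewrite lee_fin; exact/lefP/nd_nnsfun_approx.
under eq_fun do rewrite integral_density_nnsfun.
rewrite -monotone_convergence//.
- apply: eq_integral => x _; apply/cvg_lim => //.
  by apply: cvgeZr => //; exact: hf.
- move=> n; apply: emeasurable_funM; exact/measurable_EFinP.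
- by move=> n x _; rewrite -EFinM lee_fin mulr_ge0.
- move=> x _ m n mn; rewrite -!EFinM lee_fin ler_wpM2r//.
  exact/lefP/nd_nnsfun_approx.
Qed.

End density.

(* [1 + u <= expR u] with [u = (1 - r^2) x^2 / (2 s^2)]; integrating in [x] and
   letting [r] tend to 1 bounds the second moment. *)
Lemma normal_pdf_second_moment_le (R : realType) (s r x : R) :
  0 < s -> 0 < r ->
  normal_pdf 0 s x * (1 + (1 - r ^+ 2) / (s ^+ 2 *+ 2) * x ^+ 2)
    <= r^-1 * normal_pdf 0 (s / r) x.
Proof.
move=> s0 r0; have sr0 : 0 < s / r by rewrite divr_gt0.
rewrite !normal_pdfE ?gt_eqF// /normal_fun subr0.
have -> : normal_peak (s / r) = r * normal_peak s.
  rewrite /normal_peak.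
  have -> : (s / r) ^+ 2 * pi *+ 2 = r^-1 ^+ 2 * (s ^+ 2 * pi *+ 2) by ring.
  by rewrite sqrtrM ?sqr_ge0// sqrtr_sqr gtr0_norm ?invr_gt0// invfM invrK.
rewrite -(mulrA r) mulKf ?gt_eqF// -(mulrA (normal_peak s)).
rewrite ler_wpM2l ?normal_peak_ge0//.
have -> : - x ^+ 2 / ((s / r) ^+ 2 *+ 2)
    = - x ^+ 2 / (s ^+ 2 *+ 2) + (1 - r ^+ 2) / (s ^+ 2 *+ 2) * x ^+ 2.
  by field; rewrite !gt_eqF.
by rewrite expRD ler_wpM2l ?expR_ge0// expR_ge1Dx.
Qed.

Lemma normal_second_moment_le (R : realType) (s : R) : 0 < s ->
  (\int[normal_prob 0 s]_x (x ^+ 2)%:E <= (s ^+ 2)%:E)%E.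
Proof.
move=> s0.
have m2 : measurable_fun [set: R] (fun x : R => (x ^+ 2)%:E).
  by apply/measurable_EFinP/measurable_funX.
rewrite (@integral_density _ _ _ lebesgue_measure _ (normal_pdf 0 s))//;
  last 3 first.
- by move=> x; exact: normal_pdf_ge0.
- exact: measurable_normal_pdf.
- by move=> x; rewrite lee_fin sqr_ge0.
set m := (\int[_]_x _)%E.
have m0 : (0 <= m)%E.
  apply: integral_ge0 => x _.
  by rewrite mule_ge0// lee_fin ?sqr_ge0 ?normal_pdf_ge0.
(* Integrating the pointwise bound gives [1 + (1 - r^2) / (2 s^2) * m <= 1 / r]; solving for [m]
   cancels a factor [1 - r]. *)
have key r : 0 < r < 1 ->
    (m <= (2 * s ^+ 2 / (r * (1 + r)))%:E)%E.
  move=> /andP[r0 r1]; have sr0 : 0 < s / r by rewrite divr_gt0.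
  have c0 : 0 < (1 - r ^+ 2) / (s ^+ 2 *+ 2).
    by rewrite divr_gt0 ?pmulrn_lgt0 ?exprn_gt0// subr_gt0 exprn_ilt1// ltW.
  have : (1 + ((1 - r ^+ 2) / (s ^+ 2 *+ 2))%:E * m <= r^-1%:E)%E.
    rewrite -[X in (X + _)%E](integral_normal_pdf 0 s) -ge0_integralZl_EFin//;
      last 3 first.
    - by move=> x _; rewrite mule_ge0// lee_fin ?sqr_ge0 ?normal_pdf_ge0.
    - apply: emeasurable_funM => //; apply/measurable_EFinP.
      exact: measurable_normal_pdf.
    - exact: ltW.
    have mpdf t : measurable_fun [set: R] (fun x => (normal_pdf 0 t x)%:E).
      by apply/measurable_EFinP; exact: measurable_normal_pdf.
    rewrite -ge0_integralD//; last 4 first.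
    - by move=> x _; rewrite lee_fin normal_pdf_ge0.
    - exact: mpdf.
    - move=> x _; rewrite -!EFinM lee_fin mulr_ge0 ?(ltW c0)//.
      by rewrite mulr_ge0 ?sqr_ge0 ?normal_pdf_ge0.
    - apply: measurable_funeM.
      by apply: emeasurable_funM; [exact: m2|exact: mpdf].
    have -> : (r^-1%:E = \int[lebesgue_measure]_x
        (r^-1%:E * (normal_pdf 0 (s / r) x)%:E))%E.
      rewrite ge0_integralZl_EFin ?integral_normal_pdf ?mule1//.
      - by move=> x _; rewrite lee_fin normal_pdf_ge0.
      - exact: mpdf.
      - by rewrite invr_ge0 ltW.
    apply: ge0_le_integral => //.
    - move=> x _; rewrite adde_ge0// -?EFinM lee_fin ?normal_pdf_ge0//.
      by rewrite mulr_ge0 ?(ltW c0)// mulr_ge0 ?sqr_ge0 ?normal_pdf_ge0.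
    - apply: emeasurable_funD; first exact: mpdf.
      apply: measurable_funeM.
      by apply: emeasurable_funM; [exact: m2|exact: mpdf].
    - by apply: measurable_funeM; exact: mpdf.
    - move=> x _; rewrite -!EFinM -EFinD lee_fin.
      apply: le_trans (normal_pdf_second_moment_le x s0 r0).
      by rewrite mulrDr mulr1 lerD2l [leRHS]mulrC mulrA.
  case: m m0 => [m m0|_|//]; last first.
    by rewrite gt0_muley.
  rewrite -EFinM -EFinD !lee_fin => h.
  rewrite ler_pdivlMr; last by rewrite mulr_gt0// addr_gt0.
  have s2 : 0 < s ^+ 2 by rewrite exprn_gt0.
  rewrite -(@ler_pM2l _ (1 - r)) ?subr_gt0//.
  move: h; rewrite -(@ler_pM2l _ (r * (s ^+ 2 *+ 2))); last first.
    by rewrite mulr_gt0// pmulrn_lgt0.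
  have -> : r * (s ^+ 2 *+ 2) / r = s ^+ 2 *+ 2 by field; rewrite gt_eqF.
  have -> : r * (s ^+ 2 *+ 2) * (1 + (1 - r ^+ 2) / (s ^+ 2 *+ 2) * m)
    = r * (s ^+ 2 *+ 2) + r * (1 - r ^+ 2) * m by field; rewrite gt_eqF.
  lra.
(* Any single [r], here [1 / 2], excludes an infinite [m]. *)
case: m m0 key => [m m0 key| _ key|//]; last first.
  have := key 2^-1.
  by rewrite leye_eq invr_gt0 invf_lt1 ?ltr1n ?ltr0n// => /(_ isT).
(* In place of a limit [r -> 1]: if [q = s^2 / m < 1], then [r = (1 + q) / 2] turns [key] into
   [(1 - q) (3 - q) <= 0], which is absurd. *)
rewrite lee_fin leNgt; apply/negP => sm.
have s2 : 0 < s ^+ 2 by rewrite exprn_gt0.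
have {}m0 : 0 < m by exact: lt_trans sm.
pose q := s ^+ 2 / m.
have q0 : 0 < q by rewrite divr_gt0.
have q1 : q < 1 by rewrite ltr_pdivrMr// mul1r.
have sE : s ^+ 2 = q * m by rewrite divfK// gt_eqF.
have := key ((1 + q) / 2); rewrite lee_fin ler_pdivlMr; last first.
  by rewrite mulr_gt0; lra.
have r01 : 0 < (1 + q) / 2 < 1 by lra.
move=> /(_ r01); rewrite sE mulrA (mulrC m) ler_pM2r// => h.
have : 0 < (1 - q) * (3 - q) by rewrite mulr_gt0; lra.
nra.
Qed.

(** * Covariances of linear combinations of square-integrable variables *)

Section square_integrable.
Context (dT : measure_display) (T : measurableType dT) (R : realType).
Variable P : probability T R.

Lemma Lfun2_sqr_lty (X : T -> R) : measurable_fun setT X ->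
  (\int[P]_z (X z ^+ 2)%:E < +oo)%E -> X \in Lfun P 2%:E.
Proof.
move=> mX X2; rewrite inE; apply/andP; split; rewrite inE//= /finite_norm.
rewrite unlock /Lnorm poweR_lty//.
rewrite (eq_integral (fun z => (X z ^+ 2)%:E))// => z _ /=.
by rewrite powR_mulrn// real_normK ?num_real.
Qed.

(** The Gaussian bound is transported along the law of [X]; the variance is the second moment minus
    a square, so the mean need not be computed. *)
Lemma normal_RV_variance (X : {RV P >-> R}) (s : R) : 0 < s ->
  distribution P X = normal_prob 0 s :> (set R -> \bar R) ->
  (X : T -> R) \in Lfun P 2%:E /\ ('V_P[X] <= (s ^+ 2)%:E)%E.
Proof.
move=> s0 dX.
have X2 : (\int[P]_z (X z ^+ 2)%:E <= (s ^+ 2)%:E)%E.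
  (* the normal law lives on [measurableTypeR R], whose display differs from
     the one of the codomain of [X] *)
  have mX : measurable_fun setT (X : T -> measurableTypeR R).
    exact: (measurable_funPT X).
  have := @ge0_integral_pushforward _ _ _ _ _ _ mX P setT
    (fun x : measurableTypeR R => (x ^+ 2)%:E) measurableT.
  rewrite [pushforward _ _](_ : _ = normal_prob 0 s); last exact: dX.
  move=> <-; first exact: normal_second_moment_le.
  - by apply/measurable_EFinP/measurable_funX.
  - by move=> x _; rewrite lee_fin sqr_ge0.
have XL : (X : T -> R) \in Lfun P 2%:E.
  by apply: Lfun2_sqr_lty => //; exact: le_lt_trans X2 (ltry _).
split => //; rewrite varianceE//; apply: le_trans X2.
rewrite [in leLHS]unlock -[leRHS]adde0.
by apply: leeD; [exact: lexx|rewrite oppe_le0 sqre_ge0].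
Qed.

Lemma Lfun2D (X Y : T -> R) : X \in Lfun P 2%:E -> Y \in Lfun P 2%:E ->
  (fun z => X z + Y z) \in Lfun P 2%:E.
Proof. by move=> X2 Y2; apply: (Lfun_addr_closed _ (lee1n 2)).2. Qed.

Lemma Lfun2Z (a : R) (X : T -> R) : X \in Lfun P 2%:E ->
  (fun z => a * X z) \in Lfun P 2%:E.
Proof.
move=> X2; have -> : (fun z => a * X z) = a \o* X.
  by apply/funext => z /=; rewrite mulrC.
by rewrite Lfun_scale// ler1n.
Qed.

Lemma Lfun2_lincomb (I : Type) (r : seq I) (a : I -> R) (X : I -> T -> R) :
  (forall i, X i \in Lfun P 2%:E) ->
  (fun z => \sum_(i <- r) a i * X i z) \in Lfun P 2%:E.
Proof.
move=> X2; elim: r => [|i r IH].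
  rewrite (_ : (fun _ => _) = cst 0) ?Lfun_cst//.
  by apply/funext => z; rewrite big_nil.
rewrite (_ : (fun _ => _) =
  (fun z => a i * X i z + \sum_(j <- r) a j * X j z)).
  by rewrite Lfun2D// Lfun2Z.
by apply/funext => z; rewrite big_cons.
Qed.

Lemma covariance2_fin_num (X Y : T -> R) :
  X \in Lfun P 2%:E -> Y \in Lfun P 2%:E -> covariance P X Y \is a fin_num.
Proof.
move=> X2 Y2; have PT : P setT \is a fin_num := fin_num_measure P _ measurableT.
rewrite covariance_fin_num//; [exact: Lfun_subset12|exact: Lfun_subset12|].
exact: Lfun2_mul_Lfun1.
Qed.

Lemma covariance_lincombl (I : Type) (r : seq I) (a : I -> R)
    (X : I -> T -> R) (Y : T -> R) :
  (forall i, X i \in Lfun P 2%:E) -> Y \in Lfun P 2%:E ->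
  (covariance P (fun z => \sum_(i <- r) a i * X i z)%R Y
   = (\sum_(i <- r) a i * fine (covariance P (X i) Y))%R%:E)%E.
Proof.
move=> X2 Y2; have PT : P setT \is a fin_num := fin_num_measure P _ measurableT.
elim: r => [|i r IH].
  rewrite (_ : (fun _ => _) = cst 0) ?covariance_cst_l ?big_nil//.
  by apply/funext => z; rewrite big_nil.
rewrite (_ : (fun _ => _) =
  ((a i \o* X i) \+ (fun z => \sum_(j <- r) a j * X j z))); last first.
  by apply/funext => z; rewrite big_cons /= mulrC.
rewrite covarianceDl//; last 2 first.
- by rewrite Lfun_scale// ler1n.
- exact: Lfun2_lincomb.
rewrite IH big_cons EFinD EFinM fineK ?covariance2_fin_num//.
rewrite covarianceZl//; [exact: Lfun_subset12|exact: Lfun_subset12|].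
exact: Lfun2_mul_Lfun1.
Qed.

Lemma variance_lincomb (I : Type) (r : seq I) (a : I -> R) (X : I -> T -> R) :
  (forall i, X i \in Lfun P 2%:E) ->
  ('V_P[(fun z => \sum_(i <- r) a i * X i z)%R] =
   (\sum_(i <- r) \sum_(j <- r)
      a i * a j * fine (covariance P (X i) (X j)))%R%:E)%E.
Proof.
move=> X2; rewrite /variance covariance_lincombl//; last exact: Lfun2_lincomb.
congr EFin; apply: eq_bigr => i _.
rewrite covarianceC covariance_lincombl//= mulr_sumr.
by apply: eq_bigr => j _; rewrite mulrA covarianceC.
Qed.

Lemma covariance_lincombl0 (I : Type) (r : seq I) (a : I -> R)
    (X : I -> T -> R) (Y : T -> R) :
  (forall i, X i \in Lfun P 2%:E) -> Y \in Lfun P 2%:E ->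
  (forall i, covariance P (X i) Y = 0%E) ->
  covariance P (fun z => \sum_(i <- r) a i * X i z) Y = 0%E.
Proof.
move=> X2 Y2 XY; rewrite covariance_lincombl// big1// => i _.
by rewrite XY mulr0.
Qed.

Lemma covarianceDl_cst (c : R) (X Y : T -> R) :
  X \in Lfun P 2%:E -> Y \in Lfun P 2%:E ->
  covariance P (fun z => X z + c) Y = covariance P X Y.
Proof.
move=> X2 Y2; rewrite -[X in covariance P X]/(X \+ cst c).
by rewrite covarianceDl ?Lfun_cst// covariance_cst_l adde0.
Qed.

Lemma dot_sum (n : nat) (x y : 'cV[R]_n) : dot x y = \sum_i x i 0 * y i 0.
Proof. by rewrite /dot mxE; apply: eq_bigr => i _; rewrite mxE. Qed.

(** Here [X] stands for the previous errors, [Y] for the fresh noise and [c] for the deterministic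
    bias. The cross terms between [X] and [Y] vanish and the covariance matrix of [Y] is diagonal,
    which leaves the cost minimized by the estimator. *)
Lemma variance_estimate_step (n : nat) (s c : R) (k h : 'cV[R]_n)
    (X Y : 'I_n -> T -> R) :
  (forall j, X j \in Lfun P 2%:E) -> (forall j, Y j \in Lfun P 2%:E) ->
  (forall i j, covariance P (X i) (Y j) = 0%E) ->
  (forall i j, i != j -> covariance P (Y i) (Y j) = 0%E) ->
  (forall j, ('V_P[Y j] <= (s ^+ 2)%:E)%E) ->
  ('V_P[(fun z => \sum_j k j 0 * X j z + \sum_j h j 0 * Y j z + c)%R]
   <= (dot k (covariance_mx P X *m k) + s ^+ 2 * dot h h)%R%:E)%E.
Proof.
move=> X2 Y2 XY YY VY.
have LX := Lfun2_lincomb (index_enum 'I_n) (fun j => k j 0) X2.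
have LY := Lfun2_lincomb (index_enum 'I_n) (fun j => h j 0) Y2.
rewrite /variance covarianceDl_cst; last 2 first.
- exact: Lfun2D.
- by apply: Lfun2D; [exact: Lfun2D|exact: Lfun_cst].
rewrite covarianceC covarianceDl_cst; last 2 first.
- exact: Lfun2D.
- exact: Lfun2D.
rewrite -/(variance P _) varianceD//.
rewrite covariance_lincombl0//; last first.
  move=> i; rewrite covarianceC covariance_lincombl0// => j.
  by rewrite covarianceC.
rewrite mule0 adde0 !variance_lincomb// -EFinD lee_fin lerD//.
  rewrite dot_sum le_eqVlt; apply/orP; left; apply/eqP; apply: eq_bigr => i _.
  rewrite mxE mulr_sumr; apply: eq_bigr => j _.
  by rewrite mxE -mulrA (mulrC (k j 0)).
rewrite dot_sum mulr_sumr; apply: ler_sum => i _.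
rewrite (bigD1 i)//= big1 ?addr0 => [|j ji]; last first.
  by rewrite YY ?mulr0// eq_sym.
rewrite mulrC ler_wpM2r ?sqr_ge0 -?expr2 ?sqr_ge0//.
by rewrite -lee_fin fineK ?covariance2_fin_num//; exact: VY.
Qed.

End square_integrable.

(** * Lower bound on the thresholds *)

Section thresholds.
Context (R : realType) (N : nat) (adj : rel 'I_N).

Lemma card_coupled_lt (b : rel 'I_N) (i : 'I_N) : (#|coupled adj b i| < N)%N.
Proof.
have : coupled adj b i \subset [set~ i]%SET.
  by apply/fintype.subsetP => j; rewrite !inE; case: eqP.
move=> /subset_leq_card; rewrite cardsC1 card_ord -ltnS prednK//.
exact: leq_ltn_trans (leq0n i) (ltn_ord i).
Qed.

(** Write [x] for [sqrt psi_i] and [g] for [sqrt gamma]. Dropping the cross terms in the threshold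
    equations gives [sqrt psi_j <= g] for all [j]. At most [N - 1] nodes are coupled to [i], so
    [g^2 <= x^2 + x (N - 1) g <= N x g]. *)
Lemma threshold_ge (gamma : R) (b : rel 'I_N) (psi : 'I_N -> R) (i : 'I_N) :
  0 < gamma -> is_threshold adj gamma b psi ->
  Num.sqrt gamma / N%:R <= Num.sqrt (psi i).
Proof.
move=> gamma0 psiE; set g := Num.sqrt gamma.
have N0 : (0 < N)%N by exact: leq_ltn_trans (leq0n i) (ltn_ord i).
have g0 : 0 < g by rewrite sqrtr_gt0.
have sqrt_psi_le j : Num.sqrt (psi j) <= g.
  have [psi0 psij] := psiE j.
  rewrite /g ler_wsqrtr// -[leRHS]psij lerDl mulr_ge0 ?sqrtr_ge0//.
  by apply: sumr_ge0 => l _; exact: sqrtr_ge0.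
have sum_le : \sum_(j in coupled adj b i) Num.sqrt (psi j) <= (N%:R - 1) * g.
  apply: (@le_trans _ _ (\sum_(j in coupled adj b i) g)).
    by apply: ler_sum => j _; exact: sqrt_psi_le.
  rewrite sumr_const -(mulr_natl g) ler_wpM2r ?(ltW g0)// lerBrDr.
  by rewrite natr1 ler_nat card_coupled_lt.
have [psi0 psi_gamma] := psiE i.
set x := Num.sqrt (psi i) in psi_gamma *.
have x0 : 0 < x by rewrite sqrtr_gt0.
have xE : psi i = x ^+ 2 by rewrite sqr_sqrtr// ltW.
have gE : gamma = g ^+ 2 by rewrite sqr_sqrtr// ltW.
have xg : x <= g by exact: sqrt_psi_le.
have NR : 1 <= N%:R :> R by rewrite ler1n.
have : g ^+ 2 <= x ^+ 2 + x * ((N%:R - 1) * g).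
  by rewrite -gE -[leLHS]psi_gamma xE lerD2l ler_wpM2l// ltW.
rewrite ler_pdivrMr ?ltr0n// => h.
rewrite -(@ler_pM2r _ g)//.
apply: le_trans (_ : x * g + x * ((N%:R - 1) * g) <= _).
  by rewrite -expr2 (le_trans h)// lerD2r expr2 ler_wpM2l// ltW.
by rewrite le_eqVlt; apply/orP; left; apply/eqP; ring.
Qed.

End thresholds.

(** * Comparison of the optimal weights with explicit ones *)

Section trial_weights.
Context (R : realType) (N : nat) (adj : rel 'I_N).

Lemma card_received_gt0 (b : rel 'I_N) (i : 'I_N) : b i i ->
  (0 < #|received adj b i|)%N.
Proof. by move=> bii; rewrite (cardD1 i) !inE eqxx bii. Qed.

(** The left side is the competitor's variance in units of [sigma ^ 2], when the node's previous
    estimate has variance [sigma ^ 2]. *)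
Lemma gain_factor_le (M c : R) : 1 <= M -> 0 < c <= 1 / 2 -> M * c <= 2 / 3 ->
  c ^+ 2 + (1 - c) ^+ 2 / M <= (1 + c) / (1 + 2 * c) / M.
Proof.
move=> M1 /andP[c0 c12] Mc; have M0 : 0 < M by exact: lt_le_trans M1.
have c2 : 0 < 1 + 2 * c by lra.
rewrite -subr_ge0.
(* The numerator is grouped so that [M c <= 2 / 3] and [c <= 1 / 2] make each summand
   nonnegative. *)
have -> : (1 + c) / (1 + 2 * c) / M - (c ^+ 2 + (1 - c) ^+ 2 / M)
   = (c * ((2 / 3 - M * c) * (1 + 2 * c) + 1 / 3 + c * (5 / 3 - 2 * c)))
     / ((1 + 2 * c) * M).
  by field; rewrite !gt_eqF.
rewrite divr_ge0 ?mulr_ge0 ?(ltW c0) ?(ltW M0) ?(ltW c2)//.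
rewrite !addr_ge0 ?mulr_ge0 ?subr_ge0 ?(ltW c0) ?(ltW c2)//; lra.
Qed.

(* The competitor puts weight [c] on the previous estimate of the node itself
   and spreads [1 - c] evenly over the measurements it receives. *)
Lemma optimal_error_variance_le (sigma psi c : R) (P : 'M[R]_N)
    (b : rel 'I_N) (i : 'I_N) (k h : 'cV[R]_N) :
  let M : R := #|received adj b i|%:R in
  b i i -> P i i <= sigma ^+ 2 -> c ^+ 2 <= psi -> 0 < c <= 1 / 2 ->
  M * c <= 2 / 3 ->
  optimal_weights sigma psi P (packet_vector R b i) k h ->
  error_variance sigma P (packet_vector R b i) k h
    <= (1 + c) / (1 + 2 * c) / M * sigma ^+ 2.
Proof.
move=> M bii Pii cpsi c12 Mc [_ opt].
have M1 : 1 <= M by rewrite ler1n card_received_gt0.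
have M0 : 0 < M by exact: lt_le_trans M1.
pose k' : 'cV[R]_N := \col_j (if j == i then c else 0).
pose h' : 'cV[R]_N :=
  \col_j (if j \in received adj b i then (1 - c) / M else 0).
(* Both weight vectors vanish off the received packets, and [b i i] holds, so masking leaves them
   unchanged. *)
have k'm : hadamard k' (packet_vector R b i) = k'.
  apply/matrixP => j l; rewrite !mxE.
  case: eqP => [->|_]; last by rewrite mul0r.
  by rewrite bii mulr1.
have h'm : hadamard h' (packet_vector R b i) = h'.
  apply/matrixP => j l; rewrite !mxE; case: ifPn => [|_]; last by rewrite mul0r.
  by rewrite inE => /andP[_ ->]; rewrite mulr1.
have k'dot x : dot k' x = c * x i 0.
  rewrite dot_sum (bigD1 i)//= big1 => [|j /negbTE ji]; last first.
    by rewrite mxE ji mul0r.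
  by rewrite mxE eqxx addr0.
have h'dot x : dot h' x = (1 - c) / M * \sum_(j in received adj b i) x j 0.
  rewrite dot_sum mulr_sumr [RHS]big_mkcond; apply: eq_bigr => j _.
  by rewrite mxE; case: ifP; rewrite ?mul0r.
have sumM (a : R) : \sum_(j in received adj b i) a = M * a.
  by rewrite sumr_const mulr_natl.
have adm : admissible_weights psi (packet_vector R b i) k' h'.
  split; last by rewrite k'm k'dot mxE eqxx -expr2.
  have -> : hadamard (k' + h') (packet_vector R b i) = k' + h'.
    rewrite -[in RHS]k'm -[in RHS]h'm; apply/matrixP => j l.
    by rewrite !mxE mulrDl.
  have -> x : dot (k' + h') x = dot k' x + dot h' x.
    by rewrite !dot_sum -big_split; apply: eq_bigr => j _; rewrite mxE mulrDl.
  rewrite k'dot h'dot (eq_bigr (fun=> 1)) ?sumM => [|j _]; last by rewrite mxE.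
  by rewrite mxE !mulr1 divfK ?gt_eqF//; ring.
apply: le_trans (opt _ _ adm) _.
rewrite /error_variance k'm h'm k'dot h'dot.
rewrite (eq_bigr (fun=> (1 - c) / M)) ?sumM => [|j jr]; last by rewrite mxE jr.
(* The competitor sees [P] only through [P i i], which is at most [sigma ^ 2]. *)
have -> : (P *m k') i 0 = P i i * c.
  rewrite mxE (bigD1 i)//= big1 => [|j /negbTE ji]; last first.
    by rewrite mxE ji mulr0.
  by rewrite mxE eqxx addr0.
apply: (@le_trans _ _ ((c ^+ 2 + (1 - c) ^+ 2 / M) * sigma ^+ 2)); last first.
  by rewrite ler_wpM2r ?sqr_ge0// gain_factor_le.
have -> : (c ^+ 2 + (1 - c) ^+ 2 / M) * sigma ^+ 2
  = c ^+ 2 * sigma ^+ 2 + sigma ^+ 2 * ((1 - c) / M * (M * ((1 - c) / M))).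
  by field; rewrite gt_eqF.
by rewrite lerD2r mulrCA mulrC -expr2 mulrC; rewrite [leLHS]mulrC ler_wpM2l ?sqr_ge0.
Qed.

End trial_weights.

(** * Noise variance of the estimator for fixed packet losses *)

Section noise_variance.
Context (R : realType) (N : nat) (adj : rel 'I_N) (d : nat -> R).
Context (dT : measure_display) (T : measurableType dT) (P : probability T R).
Variables (sigma gamma : R) (v : nat -> 'I_N -> T -> R).
Variables (b : nat -> rel 'I_N) (psi : nat -> 'I_N -> R).
Variables (K H : nat -> 'I_N -> 'cV[R]_N).

Let e t i z := estimation_error d (fun s j => v s j z) b K H t i.

(** The signal is isolated in the trailing constant, the bias, which no covariance sees. *)
Lemma estimation_errorS t i :
  let k := hadamard (K t.+1 i) (packet_vector R (b t.+1) i) in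
  let h := hadamard (H t.+1 i) (packet_vector R (b t.+1) i) in
  e t.+1 i = fun z => \sum_j k j 0 * e t j z + \sum_j h j 0 * v t.+1 j z
    + (\sum_j k j 0 * d t + \sum_j h j 0 * d t.+1 - d t.+1).
Proof.
move=> k h; apply/funext => z; rewrite /e /estimation_error /=.
rewrite mxE -/k -/h !dot_sum.
rewrite [RHS]addrA [X in _ = X - _]addrACA.
rewrite -[in RHS]big_split -[X in _ = _ + X - _]big_split/=.
congr (_ + _ - _); apply: eq_bigr => j _.
  by rewrite -mulrDr subrK.
by rewrite mxE -mulrDr addrC.
Qed.

Hypothesis v2 : forall t i, v t i \in Lfun P 2%:E.
Hypothesis vV : forall t i, ('V_P[v t i] <= (sigma ^+ 2)%:E)%E.
Hypothesis v_uncorrelated : forall t s i j, (t, i) != (s, j) ->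
  covariance P (v t i) (v s j) = 0%E.

Lemma estimation_error_Lfun2 t i : e t i \in Lfun P 2%:E.
Proof.
elim: t i => [|t IH] i.
  rewrite (_ : e 0 i = v 0 i)//; apply/funext => z.
  by rewrite /e /estimation_error /= mxE addrC addKr.
rewrite estimation_errorS.
by apply: Lfun2D; [apply: Lfun2D; exact: Lfun2_lincomb|exact: Lfun_cst].
Qed.

(** The error at time [t] combines noises up to time [t] only; this removes the cross terms in
    [variance_estimate_step]. *)
Lemma estimation_error_future_noise t i s j : (t < s)%N ->
  covariance P (e t i) (v s j) = 0%E.
Proof.
elim: t i => [|t IH] i ts.
  rewrite (_ : e 0 i = v 0 i).
    by rewrite v_uncorrelated// xpair_eqE negb_and neq_ltn ts.
  by apply/funext => z; rewrite /e /estimation_error /= mxE addrC addKr.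
rewrite estimation_errorS.
have e2 := estimation_error_Lfun2 t.
rewrite covarianceDl_cst//; last by apply: Lfun2D; exact: Lfun2_lincomb.
rewrite covarianceDl//; [|exact: Lfun2_lincomb|exact: Lfun2_lincomb].
rewrite !covariance_lincombl0 ?adde0// => l.
  by rewrite v_uncorrelated// xpair_eqE negb_and neq_ltn ts.
by rewrite IH// ltnW.
Qed.

Hypothesis gamma01 : 0 < gamma < 1.
Hypothesis N1 : (1 < N)%N.
Hypothesis b_refl : forall t i, b t.+1 i i.
Hypothesis psi_threshold : forall t, is_threshold adj gamma (b t.+1) (psi t.+1).
Hypothesis KH_optimal : forall t i,
  optimal_weights sigma (psi t.+1 i) (covariance_mx P (e t))
    (packet_vector R (b t.+1) i) (K t.+1 i) (H t.+1 i).

Let c := (Num.sqrt 5 - 1) / 2 * Num.sqrt gamma / N%:R.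

Let c_bounds : 0 < c <= 1 / 2 /\ N%:R * c <= 2 / 3.
Proof.
have /andP[g0 g1] := gamma01.
have sg0 : 0 < Num.sqrt gamma by rewrite sqrtr_gt0.
have sg1 : Num.sqrt gamma < 1 by rewrite -[ltRHS]sqrtr1 ltr_sqrt.
have NR : 2 <= N%:R :> R by rewrite ler_nat.
have N0 : 0 < N%:R :> R by lra.
have s50 : 0 <= Num.sqrt 5 :> R by exact: sqrtr_ge0.
have s52 : Num.sqrt 5 ^+ 2 = 5 :> R by rewrite sqr_sqrtr.
have s51 : 1 < Num.sqrt 5 :> R by nra.
(* The value [7 / 3] yields [(sqrt 5 - 1) / 2 <= 2 / 3], hence [N c <= 2 / 3]; then [N >= 2] gives
   [c <= 1 / 2]. *)
have s53 : Num.sqrt 5 <= 7 / 3 :> R by nra.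
have Nc : N%:R * c = (Num.sqrt 5 - 1) / 2 * Num.sqrt gamma.
  by rewrite /c; field; rewrite gt_eqF.
have Nc23 : N%:R * c <= 2 / 3.
  rewrite Nc; nra.
have c0 : 0 < c by rewrite /c !divr_gt0// mulr_gt0// divr_gt0// subr_gt0.
split=> //; rewrite c0/=; nra.
Qed.

(** Since [(sqrt 5 - 1) / 2 <= 1], the weight [c] stays below the bound of [threshold_ge]. *)
Let c_psi t i : c ^+ 2 <= psi t.+1 i.
Proof.
have /andP[g0 g1] := gamma01.
have [/andP[c0 _] _] := c_bounds.
have [psi0 _] := psi_threshold t i.
have cg : c <= Num.sqrt gamma / N%:R.
  rewrite /c -mulrA ler_piMl ?divr_ge0 ?sqrtr_ge0//.
  have s50 : 0 <= Num.sqrt 5 :> R by exact: sqrtr_ge0.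
  have s52 : Num.sqrt 5 ^+ 2 = 5 :> R by rewrite sqr_sqrtr.
  nra.
have cpsi := le_trans cg (threshold_ge i g0 (psi_threshold t)).
rewrite -[leRHS]sqr_sqrtr ?(ltW psi0)// ler_sqr ?nnegrE ?sqrtr_ge0// ?ltW//.
Qed.

Let step t i : (forall j, ('V_P[e t j] <= (sigma ^+ 2)%:E)%E) ->
  ('V_P[e t.+1 i] <= ((1 + c) / (1 + 2 * c) / #|received adj (b t.+1) i|%:R
    * sigma ^+ 2)%:E)%E.
Proof.
move=> Ve; have e2 := estimation_error_Lfun2 t.
rewrite estimation_errorS.
apply: le_trans (variance_estimate_step _ _ _ _ _ _ _ _) _ => //.
- by move=> l j; exact: estimation_error_future_noise.
- by move=> l j lj; rewrite v_uncorrelated// xpair_eqE eqxx.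
have [c12 Nc] := c_bounds.
rewrite lee_fin; apply: optimal_error_variance_le (KH_optimal t i) => //.
- by rewrite mxE -lee_fin fineK ?variance_fin_num//; exact: Ve.
(* At most [N] packets arrive, so [M c <= N c <= 2 / 3]. *)
- apply: le_trans Nc; rewrite ler_wpM2r//; first by have /andP[/ltW] := c12.
  by rewrite ler_nat -[leqRHS]card_ord max_card.
Qed.

(** The induction carries only the weaker bound [sigma ^ 2]: it holds at time 0, where the error is
    the noise itself, and persists because the factor in [step] is at most 1. A last use of [step]
    gives the sharp bound. *)
Lemma noise_variance_le t i :
  ('V_P[e t.+1 i] <= ((1 + c) / (1 + 2 * c) / #|received adj (b t.+1) i|%:R
    * sigma ^+ 2)%:E)%E.
Proof.
apply: step; elim: t => [|{}t IH] j.
  rewrite (_ : e 0 j = v 0 j)//; apply/funext => z.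
  by rewrite /e /estimation_error /= mxE addrC addKr.
apply: le_trans (step _ IH) _; rewrite lee_fin ler_piMl ?sqr_ge0//.
have [/andP[c0 _] _] := c_bounds.
have M1 : 1 <= #|received adj (b t.+1) j|%:R :> R.
  by rewrite ler1n card_received_gt0.
rewrite ler_pdivrMr ?(lt_le_trans _ M1)// mul1r; apply: le_trans M1.
by rewrite ler_pdivrMr; lra.
Qed.

End noise_variance.

(** * Expectation over the packet losses *)

Section packet_losses.
Context (R : realType) (N : nat) (adj : rel 'I_N).
Context (dT : measure_display) (T : measurableType dT) (P : probability T R).
Variables (p : 'I_N -> 'I_N -> R)
  (phi : nat -> 'I_N -> 'I_N -> {RV P >-> bool}).
Hypothesis phi_prob :
  forall t i j, P (phi t i j @^-1` [set true])%classic = (p i j)%:E.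
Hypothesis phi_independent : mutually_independent
  (fun x : nat * 'I_N * 'I_N => x.1.2 != x.2)
  (fun x => phi x.1.1 x.1.2 x.2).
Variables (t : nat) (i : 'I_N).

Let others := neighborhood adj i :\ i.

(** Only neighbors other than [i] are constrained: independence is assumed for links between
    distinct nodes, and [i] always counts as received in the end. *)
Definition packet_event (A : {set 'I_N}) : set T :=
  [set w | forall j, j \in others -> phi t i j w = (j \in A)]%classic.

Let packet_indices : seq (nat * 'I_N * 'I_N) :=
  [seq (t, i, j) | j <- enum others].

(** This is the form of finite intersection that [mutually_independent] speaks of. *)
Let packet_eventE A : packet_event A =
  (\bigcap_(x in [set` packet_indices])
     (phi x.1.1 x.1.2 x.2 @^-1` [set x.2 \in A]))%classic.
Proof.
apply/seteqP; split=> w /=.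
  by move=> wA x /= /mapP[j]; rewrite mem_enum => /wA wj ->.
move=> wA j jo; have := wA (t, i, j); apply.
by rewrite /= map_f// mem_enum.
Qed.

Lemma measurable_packet_event A : measurable (packet_event A).
Proof.
rewrite packet_eventE; apply: fin_bigcap_measurable => [|x _].
  exact: finite_seq.
by rewrite -[X in measurable X]setTI; exact: measurable_funPT.
Qed.

Let packet_prob j (x : bool) :
  P (phi t i j @^-1` [set x])%classic = (if x then p i j else 1 - p i j)%:E.
Proof.
case: x => //; rewrite EFinB -(phi_prob t) -probability_setC.
  by congr (P _); apply/seteqP; split=> w /=; case: (phi t i j w).
by rewrite -[X in measurable X]setTI; exact: measurable_funPT.
Qed.

Definition packet_weight (A : {set 'I_N}) : R :=
  (\prod_(j in A) p i j) *
  (\prod_(j in neighborhood adj i :\: (i |: A)) (1 - p i j)).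

(** Independence gives one factor per other neighbor; splitting the product by membership in [A]
    separates the received packets from the lost ones. *)
Lemma probability_packet_event (A : {set 'I_N}) : A \subset others ->
  P (packet_event A) = (packet_weight A)%:E.
Proof.
move=> /fintype.subsetP AO; rewrite packet_eventE.
rewrite (phi_independent (B := fun x => [set x.2 \in A]%classic))//;
  last 2 first.
- by rewrite map_inj_uniq ?enum_uniq// => j l [].
- apply/allP => x /mapP[j]; rewrite mem_enum !inE => /andP[ji _] ->.
  by rewrite eq_sym.
rewrite big_map big_enum_cond/=.
under eq_bigr => j _ do rewrite packet_prob.
rewrite prodEFin; congr EFin.
rewrite (bigID (mem A))/=; congr (_ * _).
  apply: eq_big => [j|j /andP[_ ->]//].
  by rewrite andbT andb_idl// => /AO.
apply: eq_big => [j|j /andP[_ /negbTE ->]//].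
by rewrite !inE negb_or andbT; case: (j == i); case: (j \in A);
  rewrite /= ?andbT ?andbF.
Qed.

(** The subsets [A] are grouped by cardinality. *)
Lemma sum_packet_weight :
  \sum_(A : {set 'I_N} | A \subset others) packet_weight A / #|A|.+1%:R
  = \sum_(0 <= k < #|neighborhood adj i|) chi adj p i k / k.+1%:R.
Proof.
have -> : \sum_(0 <= k < #|neighborhood adj i|) chi adj p i k / k.+1%:R
  = \sum_(0 <= k < #|neighborhood adj i|)
      \sum_(A : {set 'I_N} | A \subset others)
        (if #|A| == k then packet_weight A / #|A|.+1%:R else 0).
  apply: eq_bigr => k _; rewrite /chi mulr_suml big_mkcondr/=.
  by apply: eq_bigr => A _; case: eqP => // ->.
rewrite exchange_big/=; apply: eq_bigr => A AO.
(* As [A] omits [i], its size is one of the values of [k]. *)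
have An : (#|A| < #|neighborhood adj i|)%N.
  rewrite (cardsD1 i (neighborhood adj i)) !inE eqxx add1n ltnS.
  exact: subset_leq_card.
rewrite big_mkord (bigD1 (Ordinal An))//= eqxx big1 ?addr0// => k.
by rewrite -val_eqE/= eq_sym => /negbTE ->.
Qed.

(** [V] is dominated almost surely by the simple function [g], whose coefficient on the event of [A]
    is [C / (#|A| + 1)], the extra packet being the node's own. Integrating [g] term by term gives
    the sum. *)
Lemma integral_packet_events_le (C : R) (V : T -> \bar R) : 0 <= C ->
  (forall w, (0 <= V w)%E) ->
  {ae P, forall w, phi t i i w /\
    (V w <= (C / #|received adj (fun i j => phi t i j w) i|%:R)%:E)%E} ->
  (\int[P]_w V w <= (C *
     \sum_(0 <= k < #|neighborhood adj i|) chi adj p i k / k.+1%:R)%:E)%E.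
Proof.
move=> C0 V0 VC; rewrite -sum_packet_weight.
pose g w := \sum_(A <- enum (powerset others))
  C / #|A|.+1%:R * \1_(packet_event A) w.
have g_term (A : {set 'I_N}) w : 0 <= C / #|A|.+1%:R * \1_(packet_event A) w.
  by rewrite mulr_ge0 ?divr_ge0 ?indicE.
have mg (A : {set 'I_N}) : measurable_fun setT
    (fun w => C / #|A|.+1%:R * \1_(packet_event A) w).
  apply: measurable_funM => //; apply: measurable_indic.
  exact: measurable_packet_event.
apply: (@le_trans _ _ (\int[P]_w (g w)%:E)%E).
  apply: ae_ge0_le_integral_nonmeasurable => //.
  - by move=> w; rewrite lee_fin sumr_ge0.
  - by apply/measurable_EFinP; apply: measurable_sum => A; exact: mg.
  apply: filterS VC => w [wii Vw]; apply: le_trans Vw _; rewrite lee_fin.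
  pose rec := received adj (fun i j => phi t i j w) i.
  have irec : i \in rec by rewrite !inE eqxx.
  (* The outcome [w] lies in the event of its own received set without [i]; the other terms are
     nonnegative and dropped. *)
  rewrite /g big_enum (bigD1 (rec :\ i))/=; last first.
    rewrite powersetE; apply/fintype.subsetP => j.
    by rewrite !inE => /and3P[-> ->].
  rewrite indicE mem_set; last first.
    by move=> j; rewrite /others !inE => /andP[-> ->].
  rewrite mulr1 -/rec (cardsD1 i rec) irec add1n lerDl.
  by apply: sumr_ge0 => A _; exact: g_term.
rewrite /g; under eq_integral do rewrite -sumEFin.
rewrite ge0_integral_sum//; last first.
- by move=> A w _; rewrite lee_fin.
- by move=> A; exact/measurable_EFinP/mg.
rewrite big_enum mulr_sumr -sumEFin.
rewrite le_eqVlt; apply/orP; left; apply/eqP.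
apply: eq_big => [A|A]; rewrite powersetE// => AO.
under eq_integral do rewrite EFinM.
rewrite ge0_integralZl_EFin//; last 2 first.
- by apply/measurable_EFinP/measurable_indic; exact: measurable_packet_event.
- by rewrite divr_ge0.
rewrite integral_indic//; last exact: measurable_packet_event.
rewrite setIT [X in (_ * X)%E](_ : _ = (packet_weight A)%:E).
  by rewrite -EFinM -mulrA [_^-1 * _]mulrC.
exact: probability_packet_event.
Qed.

End packet_losses.

(** * Assembly of the noise bound and the expectation over losses *)

Theorem proposition5p4 (R : realType) (N : nat) (adj : rel 'I_N)
  (d : nat -> R) (sigma gamma : R) (p : 'I_N -> 'I_N -> R)
  (* noise space and packet-loss space *)
  (dv dphi : measure_display)
  (Wv : measurableType dv) (Wphi : measurableType dphi)
  (Pv : probability Wv R) (Pphi : probability Wphi R)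
  (v : nat -> 'I_N -> {RV Pv >-> R})
  (phi : nat -> 'I_N -> 'I_N -> {RV Pphi >-> bool})
  (* thresholds and weights, as functions of the packet losses *)
  (psi : nat -> Wphi -> 'I_N -> R)
  (K H : nat -> Wphi -> 'I_N -> 'cV[R]_N) :
  let b (w : Wphi) (t : nat) : rel 'I_N := fun i j => phi t i j w in
  let e (w : Wphi) (t : nat) (i : 'I_N) (z : Wv) : R :=
    estimation_error d (fun s j => v s j z) (b w) (fun s => K s w) (fun s => H s w) t i in
  (1 < N)%N -> symmetric adj -> irreflexive adj ->
  0 < sigma -> 0 < gamma < 1 ->
  (forall t i, distribution Pv (v t i) = normal_prob 0 sigma :> (set R -> \bar R)) ->
  (forall t s i j, (t, i) != (s, j) ->
     covariance Pv (v t i) (v s j) = 0%E) ->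
  (forall t i j, Pphi (phi t i j @^-1` [set true])%classic = (p i j)%:E) ->
  (forall i, p i i = 1) ->
  (forall i j, j \notin neighborhood adj i -> p i j = 0) ->
  mutually_independent
    (fun x : nat * 'I_N * 'I_N => x.1.2 != x.2)
    (fun x => phi x.1.1 x.1.2 x.2) ->
  (forall t, (0 < t)%N ->
     {ae Pphi, forall w, is_threshold adj gamma (b w t) (psi t w)}) ->
  (forall t i j, measurable_fun setT (fun w => K t w i j 0)) ->
  (forall t i j, measurable_fun setT (fun w => H t w i j 0)) ->
  (forall t i,
     {ae Pphi, forall w,
       optimal_weights sigma (psi t.+1 w i) (covariance_mx Pv (e w t))
         (packet_vector R (b w t.+1) i) (K t.+1 w i) (H t.+1 w i)}) ->
  forall (i : 'I_N) (t : nat), (0 < t)%N ->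
    (\int[Pphi]_w 'V_Pv[e w t i]
     <= (((Num.sqrt 5 - 1) * Num.sqrt gamma + 2 * N%:R)
         / (2 * (Num.sqrt 5 - 1) * Num.sqrt gamma + 2 * N%:R)
         * (\sum_(0 <= k < #|neighborhood adj i|) chi adj p i k / k.+1%:R)
         * sigma ^+ 2)%:E)%E.
Proof.
move=> b e N1 _ _ sigma0 gamma01 vN v_unc phi_prob pii _ phi_ind psiT _ _ KH i.
case=> [//|t _].
have v2 t' j : (v t' j : Wv -> R) \in Lfun Pv 2%:E.
  by have [] := normal_RV_variance sigma0 (vN t' j).
have vV t' j : ('V_Pv[v t' j] <= (sigma ^+ 2)%:E)%E.
  by have [] := normal_RV_variance sigma0 (vN t' j).
(* The noise bound at one time rests on the whole history, so the almost sure hypotheses are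
   gathered over all times, and over all nodes, into single null sets. *)
have psiT' : {ae Pphi, forall w, forall s,
    is_threshold adj gamma (b w s.+1) (psi s.+1 w)}.
  by apply: ae_foralln => s; exact: psiT.
have b_refl : {ae Pphi, forall w, forall s j, b w s.+1 j j}.
  apply: ae_foralln => s; apply: filter_forall => j.
  have mt : measurable (phi s.+1 j j @^-1` [set true])%classic.
    by rewrite -[X in measurable X]setTI; exact: measurable_funPT.
  (* Losing its own packet has probability [1 - p j j = 0]. *)
  exists (~` (phi s.+1 j j @^-1` [set true]))%classic; split.
  - exact: measurableC.
  - by apply: etrans (probability_setC _ mt) _; rewrite phi_prob pii subee.
  - by move=> w.
have KH' : {ae Pphi, forall w, forall s j,
    optimal_weights sigma (psi s.+1 w j) (covariance_mx Pv (e w s))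
      (packet_vector R (b w s.+1) j) (K s.+1 w j) (H s.+1 w j)}.
  by apply: ae_foralln => s; apply: filter_forall => j; exact: KH.
pose c : R := (Num.sqrt 5 - 1) / 2 * Num.sqrt gamma / N%:R.
have [gamma0 _] := andP gamma01.
have N0 : 0 < N%:R :> R by rewrite ltr0n ltnW.
have a0 : 0 < (Num.sqrt 5 - 1) * Num.sqrt gamma.
  rewrite mulr_gt0 ?sqrtr_gt0// subr_gt0 -[ltLHS]sqrtr1 ltr_sqrt//.
  by rewrite ltr1n.
have c0 : 0 < c.
  by rewrite divr_gt0// mulrAC divr_gt0.
pose C := (1 + c) / (1 + 2 * c) * sigma ^+ 2.
have C0 : 0 <= C by rewrite mulr_ge0 ?sqr_ge0// divr_ge0; lra.
rewrite [leRHS](_ : _ = (C *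
    \sum_(0 <= k < #|neighborhood adj i|) chi adj p i k / k.+1%:R)%:E)%E.
  apply: (integral_packet_events_le phi_prob phi_ind (t := t.+1)) => //.
    by move=> w; exact: variance_ge0.
  apply: filterS3 psiT' b_refl KH' => w psiw bw KHw; split; first exact: bw.
  rewrite /C mulrAC.
  exact: (noise_variance_le (psi := fun s => psi s w) v2 vV v_unc gamma01 N1
    bw psiw KHw).
(* Multiplying numerator and denominator of [(1 + c) / (1 + 2 c)] by [2 N] gives the stated
   factor. *)
congr EFin; rewrite mulrAC; congr (_ * _ * _).
rewrite /c; move: a0; set x := Num.sqrt 5; set y := Num.sqrt gamma => a0; field.
by rewrite !gt_eqF//; nra.
Qed.
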